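(* For each integer $k\geq 1$, let $p_k,q_k,z_k\in\mathbb{Z}[t]$ be the polynomials such that for every matroid $\mathsf{M}$ of rank $k$ having a circuit-hyperplane $H$, with $\widetilde{\mathsf{M}}$ the relaxation of $\mathsf{M}$ by $H$, one has $P_{\widetilde{\mathsf{M}}}=P_{\mathsf{M}}+p_k$, $Q_{\widetilde{\mathsf{M}}}=Q_{\mathsf{M}}+q_k$ and $Z_{\widetilde{\mathsf{M}}}=Z_{\mathsf{M}}+z_k$. Then for each $k\geq1$ the coefficients of $p_k$, $q_k$ and $z_k$ are all non-negative, and \[\deg p_k=\deg q_k=\left\lfloor\frac{k-1}{2}\right\rfloor,\qquad \deg z_k=k-1.\]
   Context: All matroids are finite. For a matroid $\mathsf{M}$ on ground set $E$ with rank function $\operatorname{rk}$, $\mathscr{L}(\mathsf{M})$ denotes the set of flats. For a flat $F$, $\mathsf{M}^F$ is the restriction of $\mathsf{M}$ to $F$ and $\mathsf{M}_F$ is the contraction of $\mathsf{M}$ by $F$ (ground set $E\smallsetminus F$, rank $A\mapsto\operatorname{rk}(A\cup F)-\operatorname{rk}(F)$). $\chi_{\mathsf{M}}(t)=\sum_{A\subseteq E}(-1)^{|A|}t^{\operatorname{rk}(\mathsf{M})-\operatorname{rk}(A)}$. The Kazhdan--Lusztig polynomial $P_{\mathsf{M}}\in\mathbb{Z}[t]$ is uniquely determined by: (1) if $\operatorname{rk}(\mathsf{M})=0$, $P_{\mathsf{M}}=1$ if $E=\varnothing$ and $0$ otherwise; (2) if $\operatorname{rk}(\mathsf{M})>0$,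 $\deg P_{\mathsf{M}}<\operatorname{rk}(\mathsf{M})/2$; (3) $t^{\operatorname{rk}(\mathsf{M})}P_{\mathsf{M}}(t^{-1})=\sum_{F\in\mathscr{L}(\mathsf{M})}\chi_{\mathsf{M}^F}(t)P_{\mathsf{M}_F}(t)$. The inverse Kazhdan--Lusztig polynomial $Q_{\mathsf{M}}$ is uniquely determined by (1),(2) with $Q$ in place of $P$ and (3') $(-t)^{\operatorname{rk}(\mathsf{M})}Q_{\mathsf{M}}(t^{-1})=\sum_{F\in\mathscr{L}(\mathsf{M})}(-1)^{\operatorname{rk}(F)}Q_{\mathsf{M}^F}(t)t^{\operatorname{rk}(\mathsf{M})-\operatorname{rk}(F)}\chi_{\mathsf{M}_F}(t^{-1})$. $Z_{\mathsf{M}}(t)=\sum_{F\in\mathscr{L}(\mathsf{M})}t^{\operatorname{rk}(F)}P_{\mathsf{M}_F}(t)$. A circuit-hyperplane is a subset that is both a circuit and a hyperplane; the relaxation of $\mathsf{M}$ by a circuit-hyperplane $H$ is the matroid on $E$ with bases those of $\mathsf{M}$ together with $H$. (Polynomials $p_k,q_k,z_k$ with the stated property exist and are uniquely determined, since for each $k\ge1$ there is a rank-$k$ matroid with a circuit-hyperplane.)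
   Formalization: As p_2 = 0 and z_1 = 0, the claims deg p_2 = 0 and deg z_1 = 0 fail under the usual convention; here the zero polynomial is given degree 0, and it is also asserted that p_k ≠ 0 for k ≠ 2, q_k ≠ 0 for all k, and z_k ≠ 0 for k ≠ 1. *)

(* Defs.v *)
From mathcomp Require Import all_boot all_order all_algebra.

Set Implicit Arguments.
Unset Strict Implicit.
Unset Printing Implicit Defensive.

Import Order.TTheory GRing.Theory Num.Theory.

(* The ground set is a subset of the ambient finite type T, so that minors of
   a matroid again live over T.  The values of rk outside the subsets of the
   ground set are irrelevant. *)
Record matroid (T : finType) := Matroid {
  ground : {set T};
  rk : {set T} -> nat;
  rk_le_card : forall A : {set T}, A \subset ground -> rk A <= #|A|;
  rk_mono : forall A B : {set T},
    A \subset B -> B \subset ground -> rk A <= rk B;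
  rk_submod : forall A B : {set T}, A \subset ground -> B \subset ground ->
    rk (A :|: B) + rk (A :&: B) <= rk A + rk B
}.

Section MatroidDefs.
Variable T : finType.
Implicit Types (M : matroid T) (A B C F H : {set T}).

Definition rank M : nat := rk M (ground M).

Definition independent M A : bool := (A \subset ground M) && (rk M A == #|A|).

Definition bases M : {set {set T}} :=
  [set B : {set T} | independent M B & #|B| == rank M].

Definition dependent M A : bool := (A \subset ground M) && ~~ independent M A.

Definition circuit M C : bool := minset [pred A : {set T} | dependent M A] C.

Definition is_flat M F : bool :=
  (F \subset ground M) &&
  [forall x in ground M :\: F, rk M F < rk M (x |: F)].

Definition flats M : {set {set T}} := [set F : {set T} | is_flat M F].

Definition hyperplane M H : bool := is_flat M H && ((rk M H).+1 == rank M).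

Definition circuit_hyperplane M H : bool := circuit M H && hyperplane M H.

Definition is_relaxation M H (M' : matroid T) : Prop :=
  ground M' = ground M /\ bases M' = H |: bases M.

Section Restriction.
Variables (M : matroid T) (F : {set T}).

Fact restriction_sub (A : {set T}) :
  A \subset ground M :&: F -> A \subset ground M.
Proof. by move=> sA; apply: subset_trans sA (subsetIl _ _). Qed.

Fact restriction_le_card A : A \subset ground M :&: F -> rk M A <= #|A|.
Proof. by move=> /restriction_sub; apply: rk_le_card. Qed.

Fact restriction_mono A B :
  A \subset B -> B \subset ground M :&: F -> rk M A <= rk M B.
Proof. by move=> sAB /restriction_sub; apply: rk_mono. Qed.

Fact restriction_submod A B :
  A \subset ground M :&: F -> B \subset ground M :&: F ->
  rk M (A :|: B) + rk M (A :&: B) <= rk M A + rk M B.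
Proof. by move=> /restriction_sub sA /restriction_sub sB; apply: rk_submod. Qed.

(* Intended for F \subset ground M; the intersection only makes the operation
   total.  The same applies to the contraction below. *)
Definition restriction : matroid T :=
  Matroid restriction_le_card restriction_mono restriction_submod.

End Restriction.

Section Contraction.
Variables (M : matroid T) (F : {set T}).

Local Notation F' := (ground M :&: F).

Definition contraction_rk (A : {set T}) : nat := rk M (A :|: F') - rk M F'.

Local Notation crk := contraction_rk.

Fact contraction_setI_sub : F' \subset ground M. Proof. exact: subsetIl. Qed.

Fact contraction_sub (A : {set T}) :
  A \subset ground M :\: F -> A :|: F' \subset ground M.
Proof.
by move=> sA; rewrite subUset contraction_setI_sub andbT (subset_trans sA) ?subsetDl.
Qed.

Fact contraction_rkK (A : {set T}) :
  A \subset ground M :\: F -> crk A + rk M F' = rk M (A :|: F').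
Proof. by move=> /contraction_sub sA; rewrite subnK // rk_mono ?subsetUr. Qed.

Fact contraction_le_card A : A \subset ground M :\: F -> crk A <= #|A|.
Proof.
move=> sA; have sAE : A \subset ground M.
  exact: subset_trans sA (subsetDl _ _).
rewrite leq_subLR addnC; apply: leq_trans (_ : rk M A + rk M F' <= _).
  exact: leq_trans (leq_addr _ _) (rk_submod sAE contraction_setI_sub).
by rewrite leq_add2r rk_le_card.
Qed.

Fact contraction_mono A B :
  A \subset B -> B \subset ground M :\: F -> crk A <= crk B.
Proof. by move=> sAB /contraction_sub sB; rewrite leq_sub2r // rk_mono // setSU. Qed.

Fact contraction_submod A B :
  A \subset ground M :\: F -> B \subset ground M :\: F ->
  crk (A :|: B) + crk (A :&: B) <= crk A + crk B.
Proof.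
move=> sA sB; rewrite -(leq_add2r (rk M F' + rk M F')) addnACA [leqRHS]addnACA.
rewrite !contraction_rkK // ?subUset ?sA //; last exact: subset_trans (subsetIl _ _) sA.
by have := rk_submod (contraction_sub sA) (contraction_sub sB); rewrite -setUIl -setUUl.
Qed.

Definition contraction : matroid T :=
  Matroid contraction_le_card contraction_mono contraction_submod.

End Contraction.
End MatroidDefs.

Local Open Scope ring_scope.

Definition charpoly_matroid (T : finType) (M : matroid T) : {poly int} :=
  \sum_(A : {set T} | A \subset ground M)
    (-1) ^+ #|A| * 'X^(rank M - rk M A).

(* With the convention that the zero polynomial has degree 0. *)
Definition pdeg (p : {poly int}) : nat := (size p).-1.

(* t ^ n * p(t ^ -1) for deg p <= n.  This bound holds at every use below: it
   is part of the defining conditions for P and Q, and the characteristic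
   polynomial has degree at most the rank. *)
Definition reversal (n : nat) (p : {poly int}) : {poly int} :=
  \poly_(i < n.+1) p`_(n - i).

Definition matroid_poly := forall T : finType, matroid T -> {poly int}.

Definition small_degree (P : matroid_poly) : Prop :=
  forall (T : finType) (M : matroid T),
    [/\ rank M = 0%N -> P T M = (if ground M == set0 then 1 else 0)
      & (0 < rank M)%N -> (2 * pdeg (P T M) < rank M)%N].

Definition is_KL (P : matroid_poly) : Prop :=
  small_degree P /\
  forall (T : finType) (M : matroid T),
    reversal (rank M) (P T M) =
    \sum_(F in flats M)
      charpoly_matroid (restriction M F) * P T (contraction M F).

(* t ^ (rk M - rk F) * chi_{M_F}(t ^ -1) is a reversal, since
   rk M - rk F is the rank of M_F. *)
Definition is_inverse_KL (Q : matroid_poly) : Prop :=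
  small_degree Q /\
  forall (T : finType) (M : matroid T),
    (-1) ^+ rank M * reversal (rank M) (Q T M) =
    \sum_(F in flats M)
      (-1) ^+ rk M F * Q T (restriction M F) *
      reversal (rank M - rk M F) (charpoly_matroid (contraction M F)).

(* The Z-polynomial, where P is the Kazhdan-Lusztig polynomial. *)
Definition Zpoly (P : matroid_poly) : matroid_poly :=
  fun T M => \sum_(F in flats M) 'X^(rk M F) * P T (contraction M F).

(* Main.v *)
Require Import Defs.
From mathcomp Require Import all_boot all_order all_algebra.
From mathcomp Require Import zify ring.

(** Taking for M the direct sum of U_{k-1,k} and a coloop, the relaxation at the
    k-element circuit is U_{k,k+1}, and P, Q are unchanged by adding a coloop
    while Z is multiplied by 1 + t.  Hence p_k, q_k are the increments in k of
    the polynomials P, Q of U_{k,k+1}, whose coefficients are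
      C(k-i-1,i) C(k+1,i) / (i+1)   and   C(k+1,i+1) - C(k+1,i)   (2i < k).
    For P this is checked through the coefficients C(k+1,m) C(k,m) / (m+1) of Z,
    whose symmetry is equivalent to the defining recursion by binomial
    inversion.  Finally z_k = sum_j C(k,j) t^j p_{k-j} - t^(k-1), where the
    subtracted term is absorbed by k t^(k-1) p_1 = k t^(k-1). *)

Set Implicit Arguments.
Unset Strict Implicit.
Unset Printing Implicit Defensive.

Import Order.TTheory GRing.Theory Num.Theory.
Local Open Scope ring_scope.

(** [P] and [Q] are known only through their axioms, so a closed formula is proved by checking that
    it satisfies the degree bound and the recursion; uniqueness does the rest. For U_{d,d+1} the
    recursion becomes a computation with binomial sums, because a flat other than the ground set is
    any set of fewer than d elements: the restriction to it is free, and the contraction by it is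
    again of the form U_{d',d'+1}. The sizes d and d + 1 would break the binomial sum, but their
    terms vanish under the formulas used, since U_{0,1} is a loop and has P = 0. The formula for Q
    comes from (1 - t)(1 + t)^(d+1), which is antisymmetric under reversal in degree d + 2: without
    its constant term, its lower half is tQ. *)

(** * Reversals of polynomials and sums over subsets *)

Lemma coef_reversal (n i : nat) (p : {poly int}) :
  (reversal n p)`_i = if (i <= n)%N then p`_(n - i) else 0.
Proof. by rewrite coef_poly ltnS. Qed.

Lemma coef_gt_pdeg (p : {poly int}) (i : nat) : (pdeg p < i)%N -> p`_i = 0.
Proof. by rewrite /pdeg => hi; apply: nth_default; case: (size p) hi. Qed.

(** In degree d - i with 2i < d both [p0] and [f0] vanish, so the difference reads off the
    coefficient of [p] at i. Allowing [p0] to differ from [p] is needed later: there [p0] is the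
    polynomial of a trivial minor of M, equal to M only up to junk values. *)
Lemma reversal_uniq (d : nat) (p p0 f f0 : {poly int}) :
  (2 * pdeg p < d)%N -> (2 * pdeg p0 < d)%N ->
  (2 * pdeg f < d)%N -> (2 * pdeg f0 < d)%N ->
  reversal d p - p0 = reversal d f - f0 -> p = f.
Proof.
move=> hp hp0 hf hf0 /polyP e; apply/polyP => i.
have [hi|hi] := ltnP (2 * i) d; last by rewrite !coef_gt_pdeg //; lia.
have := e (d - i)%N; rewrite !coefB !coef_reversal leq_subr.
rewrite subKn; last by lia.
by rewrite [p0`__]coef_gt_pdeg ?[f0`__]coef_gt_pdeg ?subr0 //; lia.
Qed.

Lemma reversal0 (p : {poly int}) : reversal 0 p = (p`_0)%:P.
Proof.
by apply/polyP => i; rewrite coef_reversal coefC; case: i.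
Qed.

Lemma reversalXM (d : nat) (p : {poly int}) :
  (size p <= d.+1)%N -> reversal d.+1 p = 'X * reversal d p.
Proof.
move=> sp; apply/polyP => i; rewrite coefXM !coef_reversal.
case: i => [|i] /=; last by rewrite ltnS subSS.
by rewrite nth_default.
Qed.

Lemma sum_subset_card (V : zmodType) (T : finType) (E : {set T}) (h : nat -> V) :
  \sum_(A : {set T} | A \subset E) h #|A| = \sum_(j < #|E|.+1) h j *+ 'C(#|E|, j).
Proof.
rewrite (partition_big (fun A : {set T} => inord #|A| : 'I_#|E|.+1) predT) //=.
apply: eq_bigr => j _; rewrite -cards_draws.
rewrite -sumr_const; apply: eq_big => [A|A /andP[sA /eqP <-]].
  rewrite !inE; case sA: (A \subset E) => //=.
  by rewrite -val_eqE /= inordK // ltnS subset_leq_card.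
by rewrite inordK // ltnS subset_leq_card.
Qed.

Lemma sum_subset_setU1 (V : zmodType) (T : finType) (e : T) (E : {set T})
    (h : {set T} -> V) : e \notin E ->
  \sum_(A : {set T} | A \subset e |: E) h A =
  \sum_(A : {set T} | A \subset E) (h A + h (e |: A)).
Proof.
move=> eE; rewrite (bigID (fun A : {set T} => e \in A)) /= addrC big_split /=.
congr (_ + _).
  apply: eq_bigl => A; apply/andP/idP => [[sA eA]|sA].
    by move: sA; rewrite -subDset (setDidPl _) // disjoint_sym disjoints1.
  split; first exact: subset_trans sA (subsetUr _ _).
  by apply: contra eE; apply: (subsetP sA).
rewrite (reindex_onto (fun A => e |: A) (fun A => A :\ e)); last first.
  by move=> A /andP[_ eA]; rewrite setD1K.
apply: eq_bigl => A; rewrite setU11 andbT.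
apply/andP/idP => [[sA /eqP eA]|sA].
  have eA' : e \notin A by rewrite -eA !inE eqxx.
  move: sA; rewrite -subDset setU1K //.
have eA' : e \notin A by apply: contra eE; apply: (subsetP sA).
by rewrite setUS // setU1K.
Qed.

(** * Matroids up to junk values, and extensions by a coloop *)

Section Matroids.
Variable T : finType.
Implicit Types (M N : matroid T) (A B F H : {set T}).

Lemma rk_set0 M : rk M set0 = 0%N.
Proof. by apply/eqP; rewrite -leqn0 -(cards0 T) rk_le_card ?sub0set. Qed.

Lemma flat_sub M F : F \in flats M -> F \subset ground M.
Proof. by rewrite inE => /andP[]. Qed.

Lemma ground_flat M : ground M \in flats M.
Proof.
by rewrite inE /is_flat subxx setDv; apply/forall_inP => x; rewrite inE.
Qed.

Lemma rank_contraction M F : F \subset ground M ->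
  rank (contraction M F) = (rank M - rk M F)%N.
Proof.
move=> sF; rewrite /rank /= /contraction_rk (setIidPr sF) setUC setDE setUIr.
by rewrite setUCr setIT (setUidPr sF).
Qed.

Lemma rank_restriction M F : F \subset ground M ->
  rank (restriction M F) = rk M F.
Proof. by move=> sF; rewrite /rank /= (setIidPr sF). Qed.

Lemma charpoly_ground0 M : ground M = set0 -> charpoly_matroid M = 1.
Proof.
move=> g0; rewrite /charpoly_matroid /rank g0 (big_pred1 set0) => [|A].
  by rewrite cards0 subnn mulr1.
by rewrite subset0.
Qed.

(* Equality of matroids up to the junk values of the rank function. *)
Definition matroid_equiv M N : Prop :=
  ground M = ground N /\ forall A, A \subset ground M -> rk M A = rk N A.

(** The direct sum of N and a coloop e, as a relation: minors of M are again related in this way to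
    minors of N, although they need not be equal as records to a constructed extension. *)
Definition coloop_ext (e : T) M N : Prop :=
  [/\ e \notin ground N, ground M = e |: ground N
    & forall A, A \subset ground M -> rk M A = (rk N (A :\ e) + (e \in A))%N].

Section Equiv.
Variables (M N : matroid T).
Hypothesis eMN : matroid_equiv M N.

Lemma equiv_rank : rank M = rank N.
Proof. by rewrite /rank; have [<- ->] := eMN. Qed.

Lemma equiv_flats : flats M = flats N.
Proof.
have [eg er] := eMN; apply/setP => F; rewrite !inE /is_flat -eg.
case sF: (F \subset ground M) => //=; apply: eq_forallb_in => x.
by rewrite inE => /andP[_ xE]; rewrite !er // subUset sub1set xE sF.
Qed.

Lemma equiv_charpoly : charpoly_matroid M = charpoly_matroid N.
Proof.
rewrite /charpoly_matroid equiv_rank; have [eg er] := eMN; rewrite -eg.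
by apply: eq_bigr => A sA; rewrite er.
Qed.

Lemma equiv_restriction F : matroid_equiv (restriction M F) (restriction N F).
Proof.
have [eg er] := eMN; split=> /= [|A /subsetIP[sA _]]; first by rewrite eg.
exact: er.
Qed.

Lemma equiv_contraction F : matroid_equiv (contraction M F) (contraction N F).
Proof.
have [eg er] := eMN; split=> /= [|A sA]; first by rewrite eg.
by rewrite /contraction_rk -eg !er ?subsetIl // contraction_sub.
Qed.

End Equiv.

Section Coloop.
Variables (e : T) (M N : matroid T).
Hypothesis cMN : coloop_ext e M N.

Let eN F : F \subset ground N -> e \notin F.
Proof. by have [eN _ _] := cMN => sF; apply: contra eN; apply: (subsetP sF). Qed.

Let subM F : F \subset ground N -> F \subset ground M.
Proof. by have [_ -> _] := cMN => sF; apply: subset_trans sF (subsetUr _ _). Qed.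

Let subM1 F : F \subset ground N -> e |: F \subset ground M.
Proof. by have [_ -> _] := cMN => sF; apply: setUS. Qed.

Lemma coloop_rk F : F \subset ground N -> rk M F = rk N F.
Proof.
move=> sF; have [_ _ ->] := cMN; last exact: subM.
rewrite (negPf (eN sF)) addn0; congr (rk N _).
by apply/setDidPl; rewrite disjoint_sym disjoints1 eN.
Qed.

Lemma coloop_rkU1 F : F \subset ground N -> rk M (e |: F) = (rk N F).+1.
Proof.
move=> sF; have [_ _ ->] := cMN; last exact: subM1.
by rewrite setU11 addn1 setU1K ?eN.
Qed.

Lemma coloop_rank : rank M = (rank N).+1.
Proof.
by rewrite /rank; have [_ -> _] := cMN; rewrite coloop_rkU1.
Qed.

Lemma coloop_charpoly :
  charpoly_matroid M = ('X - 1) * charpoly_matroid N.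
Proof.
rewrite /charpoly_matroid; have [eE -> _] := cMN; rewrite sum_subset_setU1 //.
rewrite mulr_sumr; apply: eq_bigr => A sA; rewrite coloop_rank coloop_rk //.
rewrite coloop_rkU1 // subSS cardsU1 eN // add1n subSn ?rk_mono //.
rewrite !exprS; ring.
Qed.

Lemma coloop_is_flat F : F \subset ground N -> is_flat M F = is_flat N F.
Proof.
move=> sF; have [eE eg _] := cMN; rewrite /is_flat subM // sF /=.
apply/forall_inP/forall_inP => h x; rewrite inE => /andP[xF xE].
  have := h x; rewrite inE xF eg setU1r // => /(_ isT).
  by rewrite !coloop_rk // subUset sub1set xE.
have [->|xe] := eqVneq x e; first by rewrite coloop_rkU1 ?coloop_rk.
have xN : x \in ground N by move: xE; rewrite eg !inE (negPf xe).
by rewrite !coloop_rk ?subUset ?sub1set ?xN // h // inE xF.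
Qed.

Lemma coloop_is_flatU1 F : F \subset ground N -> is_flat M (e |: F) = is_flat N F.
Proof.
move=> sF; have [eE eg _] := cMN; rewrite /is_flat subM1 // sF /=.
have sx x : x \in ground N -> x |: F \subset ground N.
  by move=> xN; rewrite subUset sub1set xN.
apply/forall_inP/forall_inP => h x.
  rewrite inE => /andP[xF xE]; have := h x.
  rewrite setUCA !coloop_rkU1 ?sx // ltnS; apply.
  by rewrite eg !inE xE negb_or xF orbT !andbT; apply: contraNneq eE => <-.
rewrite eg !inE negb_or => /andP[/andP[/negPf -> xF] /= xN].
by rewrite setUCA !coloop_rkU1 ?sx // ltnS h // inE xF.
Qed.

Lemma coloop_flats (V : zmodType) (h : {set T} -> V) :
  \sum_(F in flats M) h F = \sum_(F in flats N) (h F + h (e |: F)).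
Proof.
have flE K (g : {set T} -> V) : \sum_(F in flats K) g F =
    \sum_(F : {set T} | F \subset ground K) (if is_flat K F then g F else 0).
  rewrite -big_mkcondr; apply: eq_bigl => F; rewrite !inE /is_flat.
  by case: (_ \subset _).
rewrite !flE; have [eE -> _] := cMN; rewrite sum_subset_setU1 //.
apply: eq_bigr => F sF; rewrite coloop_is_flat // coloop_is_flatU1 //.
by case: ifP => //; rewrite addr0.
Qed.

Lemma coloop_restriction F : F \subset ground N ->
  matroid_equiv (restriction M F) (restriction N F).
Proof.
move=> sF; split=> /= [|A]; first by rewrite !(setIidPr _) ?subM.
by rewrite (setIidPr _) ?subM // => sA; rewrite coloop_rk // (subset_trans sA).
Qed.

Lemma coloop_restrictionU1 F : F \subset ground N ->
  coloop_ext e (restriction M (e |: F)) (restriction N F).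
Proof.
move=> sF; have [eE eg er] := cMN.
split=> /= [||A /subsetIP[sA _]]; last exact: er.
  by rewrite (setIidPr sF) eN.
by rewrite (setIidPr sF) (setIidPr (subM1 sF)).
Qed.

Lemma coloop_contraction F : F \subset ground N ->
  coloop_ext e (contraction M F) (contraction N F).
Proof.
move=> sF; have [eE eg er] := cMN; have eF := eN sF.
split=> /= [||A sA]; first by rewrite inE (negPf eE) andbF.
  by rewrite eg setDUl; congr (_ :|: _); apply/setDidPl; rewrite disjoints1.
rewrite /contraction_rk (setIidPr sF) (setIidPr (subM sF)) (coloop_rk sF).
have sAE : A \subset ground M by exact: subset_trans sA (subsetDl _ _).
rewrite er ?subUset ?sAE ?subM // inE (negPf eF) orbF setDUl.
have -> : F :\ e = F by apply/setDidPl; rewrite disjoint_sym disjoints1.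
rewrite addnBAC // rk_mono ?subsetUr // subUset sF andbT.
by rewrite subDset -eg.
Qed.

Lemma coloop_contractionU1 F : F \subset ground N ->
  matroid_equiv (contraction M (e |: F)) (contraction N F).
Proof.
move=> sF; have [eE eg er] := cMN; have eF := eN sF.
have gE : ground M :\: (e |: F) = ground N :\: F.
  apply/setP => x; rewrite eg !inE; have [->|//] := eqVneq x e.
  by rewrite (negPf eE) andbF.
split=> //= A; rewrite gE => sA.
have sAE : A \subset ground N by exact: subset_trans sA (subsetDl _ _).
rewrite /contraction_rk (setIidPr sF) (setIidPr (subM1 sF)) setUCA.
by rewrite !coloop_rkU1 ?subUset ?sAE // subSS.
Qed.

End Coloop.
End Matroids.

(** * Uniqueness of the Kazhdan-Lusztig and inverse Kazhdan-Lusztig polynomials *)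

Lemma small_pdeg (P : matroid_poly) (T : finType) (M : matroid T) :
  small_degree P -> (0 < rank M)%N -> (2 * pdeg (P T M) < rank M)%N.
Proof. by move=> /(_ T M) [_]. Qed.

Lemma size_small_degree (P : matroid_poly) (T : finType) (M : matroid T) :
  small_degree P -> (size (P T M) <= (rank M).+1)%N.
Proof.
move=> sP; have [h0|h] := posnP (rank M).
  have [/(_ h0) -> _] := sP T M.
  by case: ifP => _; rewrite ?size_poly1 ?size_poly0.
have := small_pdeg sP h; rewrite /pdeg.
by case: (size _) => //= n; lia.
Qed.

(** This is the degree condition for a coloop extension of [M], whose rank is one larger; [M] itself
    may have rank 0, where the polynomial is constant. *)
Lemma small_degree_coloop (P : matroid_poly) (T : finType) (M : matroid T) :
  small_degree P -> (2 * pdeg (P T M) < (rank M).+1)%N.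
Proof.
move=> sP; have [h0|h] := posnP (rank M); last first.
  exact: leq_trans (small_pdeg sP h) _.
have [/(_ h0) -> _] := sP T M.
by case: ifP => _; rewrite /pdeg ?size_poly1 ?size_poly0.
Qed.

(* As M_F for F = set0 and M^F for F = ground M are equal to M only up to junk
   values, uniqueness is stated for a whole class closed under contraction
   (resp. restriction) instead of a single matroid. *)
Lemma KL_uniq (P : matroid_poly) (T : finType)
    (C : matroid T -> {poly int} -> Prop) : is_KL P ->
  (forall M f, C M f ->
     [/\ rank M = 0%N -> f = (if ground M == set0 then 1 else 0),
         (0 < rank M)%N -> (2 * pdeg f < rank M)%N
       & (0 < rank M)%N -> exists2 g : {set T} -> {poly int},
           forall F, F \in flats M -> C (contraction M F) (g F)
         & reversal (rank M) f =
           \sum_(F in flats M) charpoly_matroid (restriction M F) * g F]) ->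
  forall M f, C M f -> P T M = f.
Proof.
move=> [sP hP] hC M; have [n] := ubnP #|ground M|.
elim: n M => // n IH M /ltnSE hn f CMf; have [f0 sf hg] := hC M f CMf.
have [r0|r0] := posnP (rank M).
  by rewrite f0 //; have [->] := sP T M.
have [g Cg eg] := hg r0; have eP := hP T M.
have IHg F : F \in flats M -> F != set0 -> P T (contraction M F) = g F.
  move=> fF F0; apply: IH (Cg F fF); apply: leq_trans hn.
  rewrite /= cardsD (setIidPr (flat_sub fF)) ltn_subrL card_gt0 F0 /=.
  rewrite card_gt0; apply: contraTneq (flat_sub fF) => ->.
  by rewrite subset0.
(* If [set0] is not a flat, that is, if M has a loop, every contraction in the recursion has a
   smaller ground set and the induction hypothesis covers all terms. *)
have [f00|f00] := boolP (set0 \in flats M); last first.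
  apply: (@reversal_uniq (rank M) _ 0 _ 0);
    rewrite ?sf ?small_pdeg /pdeg ?size_poly0 //.
  rewrite eP eg; congr (_ - _); apply: eq_bigr => F fF; rewrite IHg //.
  by apply: contraNneq f00 => <-.
have r00 : rank (contraction M set0) = rank M.
  by rewrite rank_contraction ?sub0set // rk_set0 subn0.
have [_ sg _] := hC _ _ (Cg _ f00); rewrite r00 in sg.
(* Contracting [set0] does not shrink the ground set, so this term escapes the induction. Its
   characteristic polynomial is 1, and it is moved to the left side. *)
apply: (@reversal_uniq (rank M) _ (P T (contraction M set0)) _ (g set0)).
- exact: small_pdeg.
- by rewrite -r00 small_pdeg // r00.
- exact: sf.
- exact: sg.
rewrite eP eg (bigD1 set0) //= [X in _ = X - _](bigD1 set0) //=.
rewrite charpoly_ground0 /= ?setI0 // !mul1r !(addrC _ (\sum_(_ in _ | _) _)).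
by rewrite !addrK; apply: eq_bigr => F /andP[fF F0]; rewrite IHg.
Qed.

Lemma inverse_KL_uniq (Q : matroid_poly) (T : finType)
    (C : matroid T -> {poly int} -> Prop) : is_inverse_KL Q ->
  (forall M f, C M f ->
     [/\ rank M = 0%N -> f = (if ground M == set0 then 1 else 0),
         (0 < rank M)%N -> (2 * pdeg f < rank M)%N
       & (0 < rank M)%N -> exists2 g : {set T} -> {poly int},
           forall F, F \in flats M -> C (restriction M F) (g F)
         & (-1) ^+ rank M * reversal (rank M) f =
           \sum_(F in flats M) (-1) ^+ rk M F * g F *
             reversal (rank M - rk M F) (charpoly_matroid (contraction M F))]) ->
  forall M f, C M f -> Q T M = f.
Proof.
move=> [sQ hQ] hC M; have [n] := ubnP #|ground M|.
elim: n M => // n IH M /ltnSE hn f CMf; have [f0 sf hg] := hC M f CMf.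
have [r0|r0] := posnP (rank M).
  by rewrite f0 //; have [->] := sQ T M.
have [g Cg eg] := hg r0; have eQ := hQ T M.
have IHg F : F \in flats M -> F != ground M -> Q T (restriction M F) = g F.
  move=> fF FE; apply: IH (Cg F fF); apply: leq_trans hn.
  rewrite /= (setIidPr (flat_sub fF)) proper_card //.
  by rewrite properEneq FE flat_sub.
have gM := ground_flat M.
have rE : rank (restriction M (ground M)) = rank M by rewrite rank_restriction.
have [_ sg _] := hC _ _ (Cg _ gM); rewrite rE in sg.
(* Here the term outside the induction is the one of the ground set, which is always a flat. *)
apply: (@reversal_uniq (rank M) _ (Q T (restriction M (ground M))) _
  (g (ground M))).
- exact: small_pdeg.
- by rewrite -rE small_pdeg // rE.
- exact: sf.
- exact: sg.
apply: (mulrI (unitrX (rank M) (unitrN1 _))).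
rewrite !mulrBr eQ eg (bigD1 (ground M)) //= [X in _ = X - _](bigD1 (ground M)) //=.
rewrite charpoly_ground0 /= ?setDv // subnn reversal0 coef1 /= mulr1 mulr1.
rewrite !(addrC _ (\sum_(_ in _ | _) _)) !addrK.
by apply: eq_bigr => F /andP[fF F0]; rewrite IHg.
Qed.

(** * Effect of a coloop on P, Q and Z *)

Section KLEquiv.
Variables (P Q : matroid_poly) (hP : is_KL P) (hQ : is_inverse_KL Q).
Variable T : finType.
Implicit Types M N : matroid T.

Lemma KL_equiv M N : matroid_equiv M N -> P M = P N.
Proof.
move=> eMN.
apply: (KL_uniq (C := fun M f => exists2 N, matroid_equiv M N & f = P N) hP);
  last by exists N.
move=> {eMN N}M _ [N eMN ->]; have [sP eP] := hP.
have [eg er] := eMN; have [P0 P1] := sP T N.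
rewrite (equiv_rank eMN) eg; split=> // _.
exists (fun F => P (contraction N F)) => [F _|].
  by exists (contraction N F) => //; apply: equiv_contraction.
rewrite eP (equiv_flats eMN); apply: eq_bigr => F _.
by rewrite (equiv_charpoly (equiv_restriction eMN F)).
Qed.

Lemma inverse_KL_equiv M N : matroid_equiv M N -> Q M = Q N.
Proof.
move=> eMN.
apply: (inverse_KL_uniq
  (C := fun M f => exists2 N, matroid_equiv M N & f = Q N) hQ);
  last by exists N.
move=> {eMN N}M _ [N eMN ->]; have [sQ eQ] := hQ.
have [eg er] := eMN; have [Q0 Q1] := sQ T N.
rewrite (equiv_rank eMN) eg; split=> // _.
exists (fun F => Q (restriction N F)) => [F _|].
  by exists (restriction N F) => //; apply: equiv_restriction.
rewrite eQ (equiv_flats eMN); apply: eq_bigr => F fF.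
rewrite (equiv_charpoly (equiv_contraction eMN F)) er //.
by rewrite eg flat_sub.
Qed.

(** For a flat F containing e, the contraction has lost e and is a contraction of N up to
    equivalence; the disjunct [f = P M] makes room for it in the class. *)
Lemma KL_coloop (e : T) M N : coloop_ext e M N -> P M = P N.
Proof.
move=> cMN.
apply: (KL_uniq (C := fun M f =>
  (exists2 N, coloop_ext e M N & f = P N) \/ f = P M) hP);
  last by left; exists N.
have [sP eP] := hP.
move=> {cMN N}M _ [[N cMN ->]|->]; last first.
  have [P0 P1] := sP T M; split=> // _.
  by exists (fun F => P (contraction M F)) => // F _; right.
have [eN eg er] := cMN; rewrite (coloop_rank cMN); split=> // _.
  exact: small_degree_coloop.
exists (fun F => P (contraction N (F :\ e))) => [F|].
  move=> /flat_sub; rewrite eg -subDset => sF.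
  have [eF|eF] := boolP (e \in F).
    right; apply/esym/KL_equiv; rewrite -{1}(setD1K eF).
    exact: coloop_contractionU1.
  left; exists (contraction N (F :\ e)) => //.
  have FE : F :\ e = F by apply/setDidPl; rewrite disjoint_sym disjoints1.
  by rewrite FE in sF *; apply: coloop_contraction.
(* The flats F and [e |: F] carry the same polynomial with factors 1 and ['X - 1], which add up to
   the factor ['X] gained by the reversal. *)
rewrite (coloop_flats cMN) reversalXM ?size_small_degree // eP mulr_sumr.
apply: eq_bigr => F /flat_sub sF.
have eF : e \notin F by apply: contra eN; apply: (subsetP sF).
have FE : F :\ e = F by apply/setDidPl; rewrite disjoint_sym disjoints1.
rewrite setU1K // FE (equiv_charpoly (coloop_restriction cMN sF)).
rewrite (coloop_charpoly (coloop_restrictionU1 cMN sF)); ring.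
Qed.

Lemma size_charpoly M : (size (charpoly_matroid M) <= (rank M).+1)%N.
Proof.
apply: (leq_trans (size_sum _ _ _)); apply/bigmax_leqP => A sA.
rewrite -signr_odd; case: (odd _); rewrite ?expr0 ?expr1 ?mul1r ?mulN1r ?size_polyN.
  by rewrite size_polyXn ltnS leq_subr.
by rewrite size_polyXn ltnS leq_subr.
Qed.

Lemma reversal_coloop_charpoly (e : T) M N : coloop_ext e M N ->
  reversal (rank M) (charpoly_matroid M) =
  (1 - 'X) * reversal (rank N) (charpoly_matroid N).
Proof.
move=> cMN; rewrite (coloop_charpoly cMN) (coloop_rank cMN).
have sN := size_charpoly N; apply/polyP => i.
rewrite !mulrBl !mul1r coefB coefXM !coef_reversal coefB coefXM.
case: i => [|i] /=; first by rewrite !subn0 /= (nth_default _ sN) !subr0.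
rewrite ltnS subSS; have [iN|iN] := leqP i (rank N); last first.
  by rewrite ltnNge (ltnW iN) subrr.
by rewrite subn_eq0 subnS; case: leqP.
Qed.

(** The roles are exchanged: restricting to a flat that avoids e loses the coloop. The factors of F
    and [e |: F] are now [1 - 'X] and -1, with sum [- 'X]. *)
Lemma inverse_KL_coloop (e : T) M N : coloop_ext e M N -> Q M = Q N.
Proof.
move=> cMN.
apply: (inverse_KL_uniq (C := fun M f =>
  (exists2 N, coloop_ext e M N & f = Q N) \/ f = Q M) hQ);
  last by left; exists N.
have [sQ eQ] := hQ.
move=> {cMN N}M _ [[N cMN ->]|->]; last first.
  have [Q0 Q1] := sQ T M; split=> // _.
  by exists (fun F => Q (restriction M F)) => // F _; right.
have [eN eg er] := cMN; rewrite (coloop_rank cMN); split=> // _.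
  exact: small_degree_coloop.
exists (fun F => Q (restriction N (F :\ e))) => [F|].
  move=> /flat_sub; rewrite eg -subDset => sF.
  have [eF|eF] := boolP (e \in F).
    left; exists (restriction N (F :\ e)) => //; rewrite -{1}(setD1K eF).
    exact: coloop_restrictionU1.
  right; apply/esym/inverse_KL_equiv.
  have FE : F :\ e = F by apply/setDidPl; rewrite disjoint_sym disjoints1.
  by rewrite FE in sF *; apply: (coloop_restriction cMN).
rewrite (coloop_flats cMN) reversalXM ?size_small_degree //.
rewrite exprS mulrACA eQ mulr_sumr.
apply: eq_bigr => F /flat_sub sF.
have eF : e \notin F by apply: contra eN; apply: (subsetP sF).
have FE : F :\ e = F by apply/setDidPl; rewrite disjoint_sym disjoints1.
rewrite setU1K // FE (coloop_rk cMN sF) (coloop_rkU1 cMN sF) subSS.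
rewrite (equiv_charpoly (coloop_contractionU1 cMN sF)).
have := reversal_coloop_charpoly (coloop_contraction cMN sF).
rewrite (coloop_rank (coloop_contraction cMN sF)).
rewrite rank_contraction // -subSn ?rk_mono // => ->.
rewrite exprS; ring.
Qed.

Lemma Zpoly_coloop (e : T) M N : coloop_ext e M N ->
  Zpoly P M = (1 + 'X) * Zpoly P N.
Proof.
move=> cMN; rewrite /Zpoly (coloop_flats cMN) mulr_sumr.
apply: eq_bigr => F /flat_sub sF.
rewrite (coloop_rk cMN sF) (coloop_rkU1 cMN sF).
rewrite (KL_coloop (coloop_contraction cMN sF)).
rewrite (KL_equiv (coloop_contractionU1 cMN sF)) exprS; ring.
Qed.

End KLEquiv.

(** * Binomial transforms and their inversion *)

Section BinomialTransform.
Variable R : comNzRingType.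
Implicit Types (x y : R) (a b : nat -> R) (n : nat).

(** On exponential generating functions this is multiplication by exp(xu). *)
Definition binomial_transform x a n : R :=
  \sum_(j < n.+1) (x ^+ j * a (n - j)%N) *+ 'C(n, j).
Local Notation bt := binomial_transform.

Lemma eq_bt x a b n : a =1 b -> bt x a n = bt x b n.
Proof. by move=> ab; apply: eq_bigr => j _; rewrite ab. Qed.

Lemma btD x a b n : bt x (fun m => a m + b m) n = bt x a n + bt x b n.
Proof.
by rewrite /bt -big_split; apply: eq_bigr => j _; rewrite mulrDr mulrnDl.
Qed.

Lemma btZ x c a n : bt x (fun m => c * a m) n = c * bt x a n.
Proof.
by rewrite /bt mulr_sumr; apply: eq_bigr => j _; rewrite mulrCA mulrnAr.
Qed.

(** Pascal's rule; in terms of generating functions, the derivative of a product. *)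
Lemma btS x a n : bt x a n.+1 = x * bt x a n + bt x (fun m => a m.+1) n.
Proof.
rewrite /bt [LHS]big_ord_recl [X in _ = _ + X]big_ord_recl /=.
rewrite !subn0 !bin0 !expr0 addrCA; congr (_ + _).
under eq_bigr => j _ do rewrite /bump /= add1n subSS binS mulrnDr exprS.
rewrite big_split /= addrC mulr_sumr; congr (_ + _).
  by apply: eq_bigr => j _; rewrite mulrnAr mulrA.
rewrite big_ord_recr /= bin_small // mulr0n addr0.
by apply: eq_bigr => j _; rewrite /bump /= add1n -subSn // exprS.
Qed.

(** This is exp(xu) exp(yu) = exp((x+y)u). For y = -x, together with [bt0], it is binomial
    inversion. *)
Lemma bt_comp x y a n : bt x (bt y a) n = bt (x + y) a n.
Proof.
elim: n a => [|n IH] a.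
  by rewrite /bt !big_ord1 /= ?big_ord1 !expr0 !mul1r.
rewrite !btS (eq_bt _ _ (btS y a)) btD btZ !IH; ring.
Qed.

Lemma bt0 a n : bt 0 a n = a n.
Proof.
rewrite /bt big_ord_recl big1 ?addr0 => [|j _]; last by rewrite exprS !mul0r mul0rn.
by rewrite expr0 mul1r subn0 bin0.
Qed.

Lemma bt_expr x y n : bt x (fun m => y ^+ m) n = (x + y) ^+ n.
Proof. by rewrite addrC exprDn; apply: eq_bigr => j _; rewrite mulrC. Qed.

Lemma bt_delta x n : bt x (fun m => (m == 0)%:R) n = x ^+ n.
Proof.
rewrite /bt big_ord_recr /= subnn binn mulr1 big1 ?add0r // => j _.
by rewrite subn_eq0 leqNgt ltn_ord mulr0 mul0rn.
Qed.

End BinomialTransform.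
Notation bt := binomial_transform.

(** * Rules for computing reversals *)

Section Reversal.
Implicit Types p q : {poly int}.

Lemma reversalD n p q : reversal n (p + q) = reversal n p + reversal n q.
Proof.
apply/polyP => i; rewrite coefD !coef_reversal coefD.
by case: ifP => // _; rewrite addr0.
Qed.

Lemma reversalN n p : reversal n (- p) = - reversal n p.
Proof.
apply/polyP => i; rewrite coefN !coef_reversal coefN.
by case: ifP => // _; rewrite oppr0.
Qed.

Lemma reversal_poly0 n : reversal n 0 = 0.
Proof. by apply/polyP => i; rewrite coef_reversal !coef0 if_same. Qed.

Lemma reversal_sum n I (r : seq I) (F : I -> {poly int}) :
  reversal n (\sum_(i <- r) F i) = \sum_(i <- r) reversal n (F i).
Proof. exact: (big_morph _ (reversalD n) (reversal_poly0 n)). Qed.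

Lemma reversalMn n p m : reversal n (p *+ m) = reversal n p *+ m.
Proof.
by elim: m => [|m IH]; rewrite ?mulr0n ?reversal_poly0 // !mulrS reversalD IH.
Qed.

Lemma reversal_sign n p m : reversal n ((-1) ^+ m * p) = (-1) ^+ m * reversal n p.
Proof.
by rewrite -signr_odd; case: (odd m); rewrite ?mul1r // !mulN1r reversalN.
Qed.

Lemma reversalXn n m : (m <= n)%N -> reversal n 'X^m = 'X^(n - m).
Proof.
move=> mn; apply/polyP => i; rewrite coef_reversal !coefXn.
case: leqP => ni; last by rewrite (_ : i == _ = false) //; lia.
by congr ((nat_of_bool _)%:R); lia.
Qed.

Lemma reversal_XnM n m p : (m <= n)%N -> reversal n ('X^m * p) = reversal (n - m) p.
Proof.
move=> mn; apply/polyP => i; rewrite !coef_reversal coefXnM.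
have [i1|i1] := leqP i (n - m).
  by rewrite (leq_trans i1 (leq_subr _ _)) ifF ?[(n - i - m)%N]subnAC //; lia.
by case: ifP => // ni; rewrite ifT //; lia.
Qed.

End Reversal.

(* Kazhdan-Lusztig data of the uniform matroid of rank d on d + 1 elements.
   The coefficient of t^i in P is 'C(d - i - 1, i) * 'C(d + 1, i) / (i + 1);
   the difference below avoids the division. *)
Definition uniform_KL_coef (d i : nat) : int :=
  ('C(d - i.+1, i) * 'C(d.+1, i.+1))%:R - ('C(d - i, i.+1) * 'C(d.+1, i))%:R.

(** The bound [i < uphalf d] says 2i < d; in particular d = 0 gives 0, as it should for a loop. *)
Definition uniform_KL (d : nat) : {poly int} :=
  \poly_(i < uphalf d) uniform_KL_coef d i.

Definition uniform_inverse_KL (d : nat) : {poly int} :=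
  \poly_(i < uphalf d) ('C(d.+1, i.+1)%:R - 'C(d.+1, i)%:R).

(** The exponent for a set of j elements is d - min(j, d); truncated subtraction gives this also for
    the full set, j = d + 1. *)
Definition uniform_charpoly (d : nat) : {poly int} :=
  \sum_(j < d.+2) ((-1) ^+ j * 'X^(d - j)) *+ 'C(d.+1, j).

(** The first term belongs to the ground set. In the transform, m counts the elements that remain
    after a contraction; m = 0 and m = 1 both contribute [uniform_KL 0], which is 0. *)
Definition uniform_Z (d : nat) : {poly int} :=
  'X^d + bt 'X (fun m => uniform_KL m.-1) d.+1.

Lemma uniform_KL0 : uniform_KL 0 = 0.
Proof. by apply/polyP => i; rewrite coef_poly coef0. Qed.

Lemma uniform_KL1 : uniform_KL 1 = 1.
Proof. by apply/polyP => i; rewrite coef_poly coef1; case: i. Qed.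

(** After multiplication by i + 1, the two products in the definition become d + 1 - i and d - i
    times the right-hand side. *)
Lemma uniform_KL_coefE d i : (i < d)%N ->
  i.+1%:R * uniform_KL_coef d i = ('C(d - i.+1, i) * 'C(d.+1, i))%:R.
Proof.
move=> id; rewrite /uniform_KL_coef.
have [a ->] : exists a, d = (a + i.+1)%N by exists (d - i.+1)%N; lia.
rewrite addnK (_ : a + i.+1 - i = a.+1)%N; last by lia.
have h1 := mul_bin_left (a + i.+1).+1 i; have h2 := mul_bin_diag a.+1 i.
rewrite /= in h1 h2.
rewrite (_ : (a + i.+1).+1 - i = a.+2)%N in h1; last by lia.
move: h1 h2 => /(congr1 (fun m => m%:R : int)) h1 /(congr1 (fun m => m%:R : int)).
move: h1; rewrite !natrM => h1 h2.
rewrite mulrBr mulrCA h1 [X in _ - X]mulrA -h2 -[a.+2]add1n natrD; ring.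
Qed.

Lemma uniform_KL_coef_ge0 d i : (i < d)%N -> 0 <= uniform_KL_coef d i.
Proof.
move=> id; rewrite -(@pmulr_rge0 _ i.+1%:R) ?ltr0Sn //.
by rewrite uniform_KL_coefE // ler0n.
Qed.

(** With d + i in place of d, the truncation becomes i < d and is accounted for by the vanishing of
    C(d-1, i). *)
Lemma coef_uniform_KL d i : (0 < d)%N ->
  i.+1%:R * (uniform_KL (d + i))`_i = ('C(d.-1, i) * 'C((d + i).+1, i))%:R.
Proof.
move=> d0; rewrite coef_poly; case: ifP => [_|hi].
  rewrite uniform_KL_coefE; last by lia.
  by congr ('C(_, _) * _)%:R; lia.
rewrite bin_small ?mulr0 //.
by move: hi; rewrite gtn_uphalf_double; lia.
Qed.

(** Both sides are the multinomial coefficient (n+l+i)! / (n! l! i!). *)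
Lemma bin_mul_sub n l i :
  ('C(n + l + i, l) * 'C(n + i, i) = 'C(n + l + i, l + i) * 'C(l + i, i))%N.
Proof.
have f0 m : (0 < m`!)%N by exact: fact_gt0.
have h1 := @bin_fact (n + l + i) l ltac:(lia).
have h2 := @bin_fact (n + i) i ltac:(lia).
have h3 := @bin_fact (n + l + i) (l + i) ltac:(lia).
have h4 := @bin_fact (l + i) i ltac:(lia).
rewrite (_ : n + l + i - l = n + i)%N in h1; last by lia.
rewrite addnK in h2.
rewrite (_ : n + l + i - (l + i) = n)%N in h3; last by lia.
rewrite addnK in h4.
apply/eqP; rewrite -(eqn_pmul2r (f0 l)) -(eqn_pmul2r (f0 i)) -(eqn_pmul2r (f0 n)).
apply/eqP; transitivity (n + l + i)`!%N.
  by rewrite -h1 -h2; ring.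
by rewrite -h3 -h4; ring.
Qed.

(** The coefficients are Narayana numbers. For m < d, Vandermonde's identity for d = (d-m-1) + (m+1)
    matches the defining sum term by term, once the summation index is reversed to i = m - j. *)
Lemma coef_uniform_Z d m : (m <= d)%N ->
  m.+1%:R * (uniform_Z d)`_m = ('C(d.+1, m) * 'C(d, m))%:R.
Proof.
rewrite coefD coefXn coef_sum.
under eq_bigr => j _ do rewrite coefMn coefXnM -if_neg -leqNgt.
rewrite leq_eqVlt => /predU1P[->|md].
  (* In degree d only the flat [ground M] contributes: the other terms have too small a degree. *)
  rewrite eqxx big1 ?addr0 ?mulr1 => [|j _]; last first.
    rewrite coef_poly; case: ifP => jd; last by rewrite mul0rn.
    by rewrite subSn //= gtn_uphalf_double ifF ?mul0rn //; lia.
  by rewrite binSn binn muln1.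
rewrite (ltn_eqF md) add0r.
pose G j : int := (uniform_KL (d - j))`_(m - j) *+ 'C(d.+1, j).
transitivity (m.+1%:R * \sum_(j < m.+1) G j).
  congr (_ * _); rewrite (big_ord_widen d.+2); last by lia.
  rewrite [RHS]big_mkcond; apply: eq_bigr => j _; rewrite ltnS.
  by case: ifP => jm; rewrite ?mul0rn // subSn //; lia.
rewrite (reindex_inj rev_ord_inj) /= mulr_sumr.
rewrite (_ : 'C(d, m) = 'C(d - m.+1 + m.+1, m)); last by congr 'C(_, _); lia.
rewrite -binomial.Vandermonde natrM natr_sum mulr_sumr.
apply: eq_bigr => i _; have im := ltn_ord i; rewrite ltnS in im.
rewrite {}/G subSS subKn // (_ : d - (m - i) = d - m + i)%N; last by lia.
apply: (@mulfI _ i.+1%:R); first by rewrite pnatr_eq0.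
have e0 := @coef_uniform_KL (d - m) i ltac:(lia).
rewrite -[_ *+ 'C(_, _)]mulr_natr [LHS](_ : _ = m.+1%:R *
  (i.+1%:R * (uniform_KL (d - m + i))`_i) * 'C(d.+1, m - i)%:R); last by ring.
rewrite e0.
rewrite -!natrM; congr (_%:R).
have e1 : ('C(d.+1, m - i) * 'C((d - m + i).+1, i) = 'C(d.+1, m) * 'C(m, i))%N.
  have := bin_mul_sub (d - m).+1 (m - i) i; rewrite !addSn subnK //.
  by rewrite -addnA subnK // subnK // ltnW.
have e2 : (i.+1 * 'C(m.+1, m - i) = m.+1 * 'C(m, i))%N.
  by rewrite -(subSS i m) bin_sub ?ltnS // -mul_bin_diag.
rewrite -subnS.
transitivity (m.+1 * 'C(d - m.+1, i) *
  ('C(d.+1, m - i) * 'C((d - m + i).+1, i)))%N; first by ring.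
rewrite e1; transitivity ('C(d.+1, m) * 'C(d - m.+1, i) * (m.+1 * 'C(m, i)))%N.
  by ring.
by rewrite -e2; ring.
Qed.


Lemma size_uniform_KL d : (size (uniform_KL d) <= uphalf d)%N.
Proof. exact: size_poly. Qed.

Lemma reversal_uniform_Z d : reversal d (uniform_Z d) = uniform_Z d.
Proof.
apply/polyP => m; rewrite coef_reversal; case: leqP => md; last first.
  rewrite coefD coefXn gtn_eqF // add0r coef_sum big1 // => j _.
  rewrite coefMn coefXnM; case: ifP => mj; first by rewrite mul0rn.
  rewrite nth_default ?mul0rn //; apply: (leq_trans (size_uniform_KL _)).
  by rewrite leq_uphalf_double; lia.
apply: (@mulfI _ (m.+1 * (d - m).+1)%:R).
  by rewrite pnatr_eq0 muln_eq0.
rewrite natrM -mulrA coef_uniform_Z ?leq_subr // mulrAC coef_uniform_Z //.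
rewrite -!natrM bin_sub //; congr (_%:R).
have := mul_bin_left d.+1 m; rewrite subSn // -(subSS m d) bin_sub //.
by rewrite mulnA => ->; rewrite -mulnA mulnC.
Qed.

Lemma uniform_KL_recursion d :
  reversal d (uniform_KL d) =
  uniform_charpoly d +
    bt ('X - 1) (fun m => uniform_KL m.-1) d.+1.
Proof.
pose A m := uniform_KL m.-1; pose rA m := reversal m.-1 (A m).
(* [W] is what the term of the ground set leaves when the symmetry of [uniform_Z] is written with
   transforms. Under [bt (-1)] its power of ['X] yields the characteristic polynomial, and the
   powers of 1 yield 0^(d+1) = 0. *)
pose W m : {poly int} := 'X^(m.-1) + -1 * 1 ^+ m.
have step m : bt 1 rA m = bt 'X A m + W m.
  case: m => [|m].
    rewrite /bt !big_ord1 /rA /A /W /= uniform_KL0 reversal_poly0; ring.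
  have := reversal_uniform_Z m; rewrite /uniform_Z -/A reversalD.
  rewrite reversalXn // subnn expr0 reversal_sum => /esym e.
  have {}e : bt 'X A m.+1 + 'X^m - 1 = 
     \sum_(i < m.+2) reversal m ('X^i * A (m.+1 - i)%N *+ 'C(m.+1, i)).
    by rewrite addrC -[in RHS](addrK 1 (\sum_(_ < _) _)) [in RHS](addrC _ 1) -e; ring.
  rewrite /W expr1n mulr1 addrA e; apply: eq_bigr => j _.
  rewrite reversalMn expr1n mul1r; congr (_ *+ _).
  (* At j = m + 1 the shift by ['X^j] exceeds the degree of the reversal, but there [A 0] is 0. *)
  have := ltn_ord j; rewrite ltnS leq_eqVlt => /predU1P[->|jm].
    by rewrite subnn /rA /A /= uniform_KL0 mulr0 !reversal_poly0.
  by rewrite reversal_XnM // /rA subSn.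
have : bt (-1) (bt 1 rA) d.+1 = bt (-1) (fun m => bt 'X A m + W m) d.+1.
  exact: eq_bt.
rewrite bt_comp addNr bt0 btD bt_comp /rA /A /= addrC => ->.
rewrite btD btZ bt_expr addNr expr0n mulr0 addr0 [_ + 'X]addrC; congr (_ + _).
apply: eq_bigr => j _; congr (_ * 'X^_ *+ _); case: (val j) => [|i] /=; lia.
Qed.

(** The reversal is (1 - X)^(d+1), except that the full set contributes a multiple of X^d instead of
    X^(d+1). The factor ['X] turns the correction into a (d+1)-st power, so that [bt_expr] applies
    to both terms. *)
Lemma reversal_uniform_charpoly d :
  'X * reversal d (uniform_charpoly d) =
  'X * (1 - 'X) ^+ d.+1 + (1 - 'X) * (- 'X) ^+ d.+1.
Proof.
rewrite /uniform_charpoly reversal_sum exprDn.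
rewrite [in LHS]big_ord_recr [in RHS]big_ord_recr /= !subnn !binn !mulr1n expr1n.
rewrite reversal_sign (_ : (d - d.+1 = 0)%N); last by lia.
rewrite reversalXn // subn0.
rewrite [X in 'X * (X + _)](_ : _ =
  \sum_(i < d.+1) 1 ^+ (d.+1 - i) * (- 'X) ^+ i *+ 'C(d.+1, i)).
  rewrite [(- 'X) ^+ _]exprNn !exprS. ring.
apply: eq_bigr => j _; rewrite reversalMn reversal_sign expr1n mul1r.
rewrite reversalXn ?leq_subr // subKn; last by rewrite -ltnS.
by rewrite [(- 'X) ^+ _]exprNn.
Qed.

Lemma coef_1DX n i : ((1 + 'X : {poly int}) ^+ n)`_i = 'C(n, i)%:R.
Proof.
rewrite exprDn coef_sum; under eq_bigr => j _.
  by rewrite expr1n mul1r coefMn coefXn; over.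
have [ni|ni] := ltnP i n.+1; last first.
  rewrite bin_small // big1 // => j _; rewrite gtn_eqF ?mul0rn //.
  exact: leq_trans (ltn_ord j) ni.
rewrite (bigD1 (Ordinal ni)) //= eqxx big1 ?addr0 // => j.
by rewrite -val_eqE eq_sym => /negPf /= ->; rewrite mul0rn.
Qed.

Lemma coef_uniform_inverse_KL d i : (uniform_inverse_KL d)`_i =
  if (2 * i < d)%N then 'C(d.+1, i.+1)%:R - 'C(d.+1, i)%:R else 0.
Proof. by rewrite coef_poly gtn_uphalf_double mul2n. Qed.

Lemma reversal_uniform_inverse_KL d :
  'X * (reversal d (uniform_inverse_KL d) - uniform_inverse_KL d) =
  1 - 'X^(d.+2) - (1 - 'X) * (1 + 'X) ^+ d.+1.
Proof.
apply/polyP => -[|m]; rewrite coefXM /=.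
  by rewrite mulrBl mul1r !coefB coef1 coefXn coefXM coef_1DX bin0.
rewrite mulrBl mul1r !coefB coef1 coefXn coefXM !coef_1DX /= eqSS.
rewrite coef_reversal !coef_uniform_inverse_KL.
have [md|md] := leqP m d; last first.
  rewrite ifF; last by lia.
  rewrite bin_small //; have [->|mn] := eqVneq m d.+1; first by rewrite binn mulr1n; ring.
  by rewrite mulr0n bin_small; [ring | lia].
rewrite (ltn_eqF (_ : m < d.+1)%N) ?mulr0n //.
have [h|h] := ltnP (2 * m) d.
  by rewrite ifF; [ring | lia].
have e1 : 'C(d.+1, (d - m).+1) = 'C(d.+1, m).
  by rewrite -subSn // bin_sub // ltnW.
have e2 : 'C(d.+1, d - m) = 'C(d.+1, m.+1).
  by rewrite -(subSS m d) bin_sub.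
rewrite e1 e2; case: ifP => h'; first by ring.
have -> : 'C(d.+1, m) = 'C(d.+1, m.+1).
  by rewrite -e2; congr 'C(_, _); lia.
ring.
Qed.

Lemma uniform_inverse_KL_recursion d :
  (-1) ^+ d * reversal d (uniform_inverse_KL d) =
  (-1) ^+ d * uniform_inverse_KL d +
    bt (-1) (fun m => reversal m.-1 (uniform_charpoly m.-1)) d.+1.
Proof.
apply/eqP; rewrite addrC -subr_eq -mulrBr; apply/eqP.
apply: (@mulfI _ 'X); first by rewrite polyX_eq0.
rewrite mulrCA reversal_uniform_inverse_KL -btZ.
(* At m = 0 the index [m.-1] is 0 once more and the left side vanishes, while the two powers add up
   to 1; the delta term corrects this. *)
rewrite (@eq_bt _ _ _ (fun m => 'X * (1 - 'X) ^+ m + (1 - 'X) * (- 'X) ^+ m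
   + -1 * (m == 0)%:R)); last first.
  case=> [|m] /=; last by rewrite reversal_uniform_charpoly mulr0 addr0.
  by rewrite reversal_uniform_charpoly !expr0 !expr1 mulr1; ring.
rewrite !btD !btZ bt_delta !bt_expr addrA addNr add0r.
have -> : -1 - 'X = -1 * (1 + 'X) :> {poly int} by ring.
rewrite exprMn [(- 'X) ^+ _]exprNn !exprS.
ring.
Qed.

(** * P, Q and Z of the uniform matroids U_{d,d+1} *)

Section UniformMatroids.
Variable T : finType.
Implicit Types (M N : matroid T) (A F : {set T}).

Definition free_matroid M : Prop :=
  forall A, A \subset ground M -> rk M A = #|A|.

Definition corank1_uniform (d : nat) M : Prop :=
  #|ground M| = d.+1 /\
  forall A, A \subset ground M -> rk M A = minn #|A| d.

Lemma free_charpoly M : free_matroid M ->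
  charpoly_matroid M = ('X - 1) ^+ #|ground M|.
Proof.
move=> fM; rewrite /charpoly_matroid /rank fM //.
under eq_bigr => A sA do rewrite fM //.
rewrite (sum_subset_card _ (fun j => (-1) ^+ j * 'X^(#|ground M| - j))).
by rewrite exprDn; apply: eq_bigr => j _; rewrite mulrC.
Qed.

(** Every element of a free matroid is a coloop, so all can be removed down to the empty matroid. *)
Lemma inverse_KL_free (Q : matroid_poly) M :
  is_inverse_KL Q -> free_matroid M -> Q T M = 1.
Proof.
move=> hQ; have [n] := ubnP #|ground M|.
elim: n M => // n IH M /ltnSE hn fM.
have [g0|[e eM]] := set_0Vmem (ground M).
  by have [h _] := hQ.1 T M; rewrite h ?g0 ?eqxx // /rank g0 rk_set0.
pose N := restriction M (ground M :\ e).
have gN : ground N = ground M :\ e by rewrite /= (setIidPr (subsetDl _ _)).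
have cMN : coloop_ext e M N.
  rewrite /coloop_ext gN setD11 setD1K //; split=> // A sA /=.
  rewrite !fM ?(subset_trans (subsetDl _ _) sA) //.
  by rewrite [in LHS](cardsD1 e) addnC.
rewrite (inverse_KL_coloop hQ cMN); apply: IH.
  by apply: leq_trans hn; rewrite gN [in ltnRHS](cardsD1 e) eM.
by move=> A /subsetIP[sA _]; apply: fM.
Qed.

Section Uniform.
Variables (d : nat) (M : matroid T).
Hypothesis uM : corank1_uniform d M.

Lemma uniform_rank : rank M = d.
Proof. by rewrite /rank uM.2 // uM.1; apply/minn_idPr. Qed.

Lemma uniform_flat F : F \subset ground M ->
  is_flat M F = (#|F| < d)%N || (F == ground M).
Proof.
move=> sF; rewrite /is_flat sF /=; have [gE rE] := uM.
have [->|FE] := eqVneq F (ground M).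
  by rewrite orbT setDv; apply/forall_inP => x; rewrite inE.
have sx x : x \in ground M -> x |: F \subset ground M.
  by move=> xE; rewrite subUset sub1set xE.
rewrite orbF; apply/forall_inP/idP => [h|h x]; last first.
  by rewrite inE => /andP[xF xE]; rewrite !rE ?sx // cardsU1 xF; lia.
have /subsetPn[x xE xF] : ~~ (ground M \subset F).
  by apply: contra FE => sE; rewrite eqEsubset sF.
have := h x; rewrite inE xF xE => /(_ isT).
by rewrite !rE ?sx // cardsU1 xF; lia.
Qed.

Lemma uniform_card_flat F : F \in flats M -> F != ground M -> (#|F| < d)%N.
Proof.
move=> fF FE; have sF := flat_sub fF.
by move: fF; rewrite inE uniform_flat // (negPf FE) orbF.
Qed.

(** The sets of d or d + 1 elements enter the right-hand sum with weight 0, which completes it to a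
    full binomial sum. *)
Lemma sum_uniform_flats (V : zmodType) (g : {set T} -> V) (h : nat -> V) :
  (forall F, F \subset ground M -> (#|F| < d)%N -> g F = h #|F|) ->
  h d = 0 -> h d.+1 = 0 ->
  \sum_(F in flats M) g F = g (ground M) + \sum_(j < d.+2) h j *+ 'C(d.+1, j).
Proof.
move=> gh h0 h1; rewrite (bigD1 (ground M)) ?ground_flat //=; congr (_ + _).
have [gE rE] := uM; rewrite -gE -sum_subset_card.
rewrite [RHS](bigID (fun F : {set T} => #|F| < d)%N) /= [X in _ = _ + X]big1.
  rewrite addr0; apply: eq_big => [F|F /andP[fF FE]]; last first.
    by apply: gh; rewrite ?flat_sub // uniform_card_flat.
  apply/andP/andP => [[fF FE]|[sF Fd]].
    by rewrite flat_sub // uniform_card_flat.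
  rewrite inE uniform_flat // Fd; split=> //.
  by apply: contraTneq Fd => ->; rewrite gE; lia.
move=> F /andP[sF]; rewrite -leqNgt => dF.
have := subset_leq_card sF; rewrite gE leq_eqVlt => /predU1P[-> //|].
by rewrite ltnS => Fd; rewrite (_ : #|F| = d) //; apply/eqP; rewrite eqn_leq Fd.
Qed.

Lemma uniform_contraction F : F \subset ground M -> (#|F| < d)%N ->
  corank1_uniform (d - #|F|) (contraction M F).
Proof.
move=> sF Fd; have [gE rE] := uM; split=> [|A sA] /=.
  by rewrite cardsD (setIidPr sF) gE subSn // ltnW.
have sAE : A \subset ground M by exact: subset_trans sA (subsetDl _ _).
rewrite /contraction_rk (setIidPr sF) !rE ?subUset ?sAE // cardsU.
have /setDidPl AF : [disjoint A & F].
  by move: sA; rewrite subsetD => /andP[].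
rewrite (_ : A :&: F = set0) ?cards0; last first.
  by apply/eqP; rewrite setI_eq0; apply/setDidPl.
lia.
Qed.

Lemma uniform_restriction F : F \subset ground M -> (#|F| < d)%N ->
  free_matroid (restriction M F).
Proof.
move=> sF Fd A /subsetIP[sA sAF] /=; rewrite uM.2 //.
by have := subset_leq_card sAF; lia.
Qed.

Lemma uniform_charpolyE : charpoly_matroid M = uniform_charpoly d.
Proof.
have [gE rE] := uM; rewrite /charpoly_matroid uniform_rank.
under eq_bigr => A sA do rewrite rE //.
rewrite (sum_subset_card _ (fun j => (-1) ^+ j * 'X^(d - minn j d))) gE.
apply: eq_bigr => j _; congr (_ * 'X^_ *+ _); lia.
Qed.

End Uniform.

Lemma equiv_uniform d M N :
  matroid_equiv M N -> corank1_uniform d N -> corank1_uniform d M.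
Proof.
move=> [eg er] [gE rE]; split=> [|A sA]; first by rewrite eg.
by rewrite er // rE // -eg.
Qed.

Lemma restriction_ground M : matroid_equiv (restriction M (ground M)) M.
Proof. by split=> //=; rewrite setIid. Qed.

Lemma pdeg_uphalf (d : nat) (p : {poly int}) :
  (0 < d)%N -> (size p <= uphalf d)%N -> (2 * pdeg p < d)%N.
Proof.
move=> d0 sp; rewrite mul2n -gtn_uphalf_double /pdeg.
by move: sp; case: (size p) => //=; rewrite uphalf_gt0.
Qed.

Lemma KL_uniform (P : matroid_poly) d M :
  is_KL P -> corank1_uniform d M -> P T M = uniform_KL d.
Proof.
move=> hP uM.
(* The second disjunct is the contraction by the ground set, which is empty. *)
apply: (KL_uniq (C := fun M f =>
  (exists2 d, corank1_uniform d M & f = uniform_KL d) \/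
  ground M = set0 /\ f = 1) hP); last by left; exists d.
move=> {d uM}M _ [[d uM ->]|[g0 ->]]; last first.
  by rewrite /rank g0 rk_set0 eqxx.
have [gE rE] := uM; rewrite (uniform_rank uM); split.
- by move=> d0; rewrite d0 uniform_KL0 -cards_eq0 gE.
- by move=> d0; rewrite pdeg_uphalf // size_uniform_KL.
move=> d0; exists (fun F => if F == ground M then 1 else uniform_KL (d - #|F|)).
  move=> F fF; case: ifP => [/eqP ->|/negbT FE]; first by right; rewrite /= setDv.
  left; exists (d - #|F|)%N => //.
  by apply: uniform_contraction; rewrite ?flat_sub ?(uniform_card_flat uM).
rewrite (sum_uniform_flats uM (h := fun j => ('X - 1) ^+ j * uniform_KL (d - j))).
- rewrite eqxx mulr1 (equiv_charpoly (restriction_ground M)).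
  rewrite (uniform_charpolyE uM) uniform_KL_recursion; congr (_ + _).
  apply: eq_bigr => j _; congr (_ * uniform_KL _ *+ _).
  by case: (nat_of_ord j) => [|i] /=; lia.
- move=> F sF Fd; rewrite ifF; last by apply: contraTF Fd => /eqP ->; rewrite gE; lia.
  rewrite free_charpoly; last exact: (uniform_restriction uM).
  by rewrite /= (setIidPr sF).
- by rewrite subnn uniform_KL0 mulr0.
- by rewrite (_ : d - d.+1 = 0)%N ?uniform_KL0 ?mulr0 //; lia.
Qed.

Lemma Zpoly_uniform (P : matroid_poly) d M :
  is_KL P -> corank1_uniform d M -> Zpoly P M = uniform_Z d.
Proof.
move=> hP uM; have [gE rE] := uM; have [sP _] := hP.
rewrite /Zpoly (sum_uniform_flats uM (h := fun j => 'X^j * uniform_KL (d - j))).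
- rewrite -/(rank M) (uniform_rank uM).
  have [h _] := sP T (contraction M (ground M)).
  rewrite h ?rank_contraction ?subnn //= setDv eqxx mulr1.
  congr (_ + _); apply: eq_bigr => j _; congr (_ * uniform_KL _ *+ _).
  by case: (nat_of_ord j) => [|i] /=; lia.
- move=> F sF Fd; rewrite rE // (KL_uniform hP (uniform_contraction uM sF Fd)).
  by rewrite (minn_idPl (ltnW Fd)).
- by rewrite subnn uniform_KL0 mulr0.
- by rewrite (_ : d - d.+1 = 0)%N ?uniform_KL0 ?mulr0 //; lia.
Qed.

Lemma reversal_uniform_charpoly0 : reversal 0 (uniform_charpoly 0) = 0.
Proof.
apply: (@mulfI _ 'X); first by rewrite polyX_eq0.
by rewrite reversal_uniform_charpoly !expr1; ring.
Qed.

Lemma inverse_KL_uniform (Q : matroid_poly) d M :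
  is_inverse_KL Q -> corank1_uniform d M -> Q T M = uniform_inverse_KL d.
Proof.
move=> hQ uM.
(* The second disjunct accommodates the restrictions to flats other than the ground set, which are
   free and have Q = 1. *)
apply: (inverse_KL_uniq (C := fun M f =>
  (exists2 d, corank1_uniform d M & f = uniform_inverse_KL d) \/ f = Q T M) hQ);
  last by left; exists d.
have [sQ eQ] := hQ.
move=> {d uM}M _ [[d uM ->]|->]; last first.
  have [Q0 Q1] := sQ T M; split=> // _.
  by exists (fun F => Q T (restriction M F)) => // F _; right.
have [gE rE] := uM; rewrite (uniform_rank uM); split.
- move=> ->; rewrite -cards_eq0 gE /=.
  by apply/polyP => i; rewrite coef_poly coef0.
- by move=> d0; rewrite pdeg_uphalf // size_poly.
move=> d0; exists (fun F => if F == ground M then uniform_inverse_KL d else 1).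
  move=> F fF; case: ifP => [/eqP ->|/negbT FE].
    by left; exists d => //; apply: equiv_uniform uM; apply: restriction_ground.
  right; rewrite inverse_KL_free //.
  by apply: (uniform_restriction uM); rewrite ?flat_sub ?(uniform_card_flat uM).
rewrite (sum_uniform_flats uM
  (h := fun j => (-1) ^+ j * reversal (d - j) (uniform_charpoly (d - j)))).
- rewrite eqxx -/(rank M) (uniform_rank uM) subnn reversal0.
  rewrite charpoly_ground0 /= ?setDv // coef1 mulr1 uniform_inverse_KL_recursion.
  congr (_ + _); apply: eq_bigr => j _.
  have -> // : (d.+1 - j).-1 = (d - j)%N.
  by case: (nat_of_ord j) => [|i] /=; lia.
- move=> F sF Fd; rewrite ifF; last by apply: contraTF Fd => /eqP ->; rewrite gE; lia.
  rewrite rE // (minn_idPl (ltnW Fd)) mulr1.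
  by rewrite (uniform_charpolyE (uniform_contraction uM sF Fd)).
- by rewrite subnn reversal_uniform_charpoly0 mulr0.
- rewrite (_ : d - d.+1 = 0)%N; last by lia.
  by rewrite reversal_uniform_charpoly0 mulr0.
Qed.

End UniformMatroids.

(** * Construction of uniform matroids and of coloop extensions *)

Section UniformMatroid.
Variables (T : finType) (d : nat).
Implicit Types A B : {set T}.

Fact uniform_le_card A : A \subset [set: T] -> (minn #|A| d <= #|A|)%N.
Proof. by rewrite geq_minl. Qed.

Fact uniform_mono A B :
  A \subset B -> B \subset [set: T] -> (minn #|A| d <= minn #|B| d)%N.
Proof. by move=> /subset_leq_card sAB _; lia. Qed.

Fact uniform_submod A B : A \subset [set: T] -> B \subset [set: T] ->
  (minn #|A :|: B| d + minn #|A :&: B| d <= minn #|A| d + minn #|B| d)%N.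
Proof.
move=> _ _; have := cardsUI A B.
have := subset_leq_card (subsetIl A B); have := subset_leq_card (subsetIr A B).
lia.
Qed.

Definition uniform_matroid : matroid T :=
  Matroid uniform_le_card uniform_mono uniform_submod.

End UniformMatroid.

Section AddColoop.
Variables (T : finType) (e : T) (N : matroid T).
Implicit Types A B : {set T}.

Let sub_ground A : A \subset e |: ground N -> A :\ e \subset ground N.
Proof. by rewrite subDset. Qed.

Definition add_coloop_rk A : nat := (rk N (A :\ e) + (e \in A))%N.

Fact add_coloop_le_card A : A \subset e |: ground N -> (add_coloop_rk A <= #|A|)%N.
Proof.
move=> sA; rewrite /add_coloop_rk [leqRHS](cardsD1 e) addnC leq_add2l.
exact: rk_le_card (sub_ground sA).
Qed.

Fact add_coloop_mono A B :
  A \subset B -> B \subset e |: ground N -> (add_coloop_rk A <= add_coloop_rk B)%N.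
Proof.
move=> sAB sB; apply: leq_add; first exact: rk_mono (setSD _ sAB) (sub_ground sB).
by case: (boolP (e \in A)) => // /(subsetP sAB) ->.
Qed.

Fact add_coloop_submod A B :
  A \subset e |: ground N -> B \subset e |: ground N ->
  (add_coloop_rk (A :|: B) + add_coloop_rk (A :&: B) <=
   add_coloop_rk A + add_coloop_rk B)%N.
Proof.
move=> sA sB; rewrite /add_coloop_rk addnACA [leqRHS]addnACA setDUl setDIl.
apply: leq_add; first exact: rk_submod (sub_ground sA) (sub_ground sB).
by rewrite !inE; do 2!case: (e \in _).
Qed.

Definition add_coloop : matroid T :=
  Matroid add_coloop_le_card add_coloop_mono add_coloop_submod.

Lemma add_coloopP : e \notin ground N -> coloop_ext e add_coloop N.
Proof. by []. Qed.

End AddColoop.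

(** * The relaxation of U_{k-1,k} plus a coloop, for k = d + 1 *)

Section Relaxation.
Variables (T : finType) (d : nat) (e : T).
Hypothesis cardT : #|T| = d.+2.

Let H : {set T} := [set~ e].
Let N : matroid T := restriction (uniform_matroid T d) H.
Let M : matroid T := add_coloop e N.
Let M' : matroid T := uniform_matroid T d.+1.

Let gN : ground N = H. Proof. by rewrite /= setTI. Qed.

Let eN : e \notin ground N. Proof. by rewrite gN !inE eqxx. Qed.

Let cMN : coloop_ext e M N. Proof. exact: add_coloopP. Qed.

Let cardH : #|H| = d.+1.
Proof. by rewrite cardsC1 cardT. Qed.

Let uN : corank1_uniform d N.
Proof. by split; rewrite // gN. Qed.

Let uM' : corank1_uniform d.+1 M'.
Proof. by split; rewrite //= cardsT. Qed.

Let gM : ground M = [set: T].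
Proof. by rewrite /= setTI setUCr. Qed.

Let rM A : rk M A = (minn #|A :\ e| d + (e \in A))%N. Proof. by []. Qed.

Lemma circuit_hyperplane_coloop : circuit_hyperplane M H.
Proof.
apply/andP; split; last first.
  rewrite /hyperplane (coloop_is_flat cMN) ?gN // (coloop_rank cMN).
  rewrite (coloop_rk cMN) ?gN // -gN eqxx andbT.
  by have := ground_flat N; rewrite inE.
have rH (A : {set T}) : A \subset H -> rk M A = minn #|A| d.
  move=> sA; rewrite (coloop_rk cMN) ?gN //.
have dM (A : {set T}) : dependent M A = (rk M A != #|A|).
  by rewrite /dependent /independent gM subsetT.
apply/minsetP; split=> [|A]; first by change (dependent M H); rewrite dM rH // cardH; lia.
change (dependent M A -> A \subset H -> A = H); rewrite dM => h sA.
apply/eqP; rewrite eqEcard sA cardH; move: h.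
by rewrite rH //; lia.
Qed.

(** The bases of [M'] are all sets of d + 1 elements. Those containing e are the bases of [M], and
    the only one avoiding e is [H]. *)
Lemma relaxation_coloop : is_relaxation M H M'.
Proof.
split; first by rewrite gM.
have bE (K : matroid T) (A : {set T}) : ground K = [set: T] ->
    (A \in bases K) = (rk K A == #|A|) && (#|A| == rank K).
  by rewrite inE /independent => ->; rewrite subsetT.
apply/setP => A; rewrite in_setU1 !bE //.
rewrite (coloop_rank cMN) (uniform_rank uN) (uniform_rank uM') rM [rk M' A]/=.
have cA := cardsD1 e A; have [eA|eA] := boolP (e \in A).
  rewrite (_ : (A == H) = false) /=; last first.
    by apply: contraTF eA => /eqP ->; rewrite !inE eqxx.
  rewrite eA in cA; lia.
have sA : A \subset H by rewrite subsetC sub1set inE.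
have -> : (A == H) = (#|A| == d.+1).
  by have := subset_leq_card sA; rewrite eqEcard sA cardH; lia.
rewrite (negPf eA) in cA; lia.
Qed.

Lemma relaxation_differences (P Q : matroid_poly) :
  is_KL P -> is_inverse_KL Q ->
  [/\ rank M = d.+1,
      P T M' - P T M = uniform_KL d.+1 - uniform_KL d,
      Q T M' - Q T M = uniform_inverse_KL d.+1 - uniform_inverse_KL d
    & Zpoly P M' - Zpoly P M = uniform_Z d.+1 - (1 + 'X) * uniform_Z d].
Proof.
move=> hP hQ; rewrite (coloop_rank cMN) (uniform_rank uN).
rewrite (KL_uniform hP uM') (inverse_KL_uniform hQ uM') (Zpoly_uniform hP uM').
rewrite (KL_coloop hP cMN) (inverse_KL_coloop hQ cMN) (Zpoly_coloop hP cMN).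
by rewrite (KL_uniform hP uN) (inverse_KL_uniform hQ uN) (Zpoly_uniform hP uN).
Qed.

End Relaxation.

(** * Signs and degrees of the increments *)

Lemma pdeg_eq (p : {poly int}) (n : nat) :
  (size p <= n.+1)%N -> 0 < p`_n -> pdeg p = n /\ p != 0.
Proof.
move=> sp pn; have np : (n < size p)%N.
  by rewrite ltnNge; apply: contraTN pn => /(nth_default 0) ->; rewrite ltxx.
rewrite /pdeg -size_poly_gt0 (leq_trans _ np) //.
by have -> : size p = n.+1 by apply/eqP; rewrite eqn_leq sp.
Qed.

Lemma size_subr_le (p q : {poly int}) n :
  (size p <= n)%N -> (size q <= n)%N -> (size (p - q)%R <= n)%N.
Proof.
move=> sp sq; apply: (leq_trans (size_polyD _ _)).
by rewrite size_polyN geq_max sp sq.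
Qed.

Lemma uphalfS_halfS d : uphalf d.+1 = (d %/ 2).+1.
Proof. by rewrite uphalfE divn2. Qed.

(** After multiplication by i + 1 the coefficient is a product of two binomials, each increasing in
    d. *)
Lemma uniform_KL_diff_ge0 d i : 0 <= (uniform_KL d.+1 - uniform_KL d)`_i.
Proof.
rewrite coefB subr_ge0 !coef_poly !gtn_uphalf_double.
case: ltnP => [id|_]; last first.
  by case: ltnP => // id; apply: uniform_KL_coef_ge0; lia.
rewrite ifT; last by lia.
rewrite -(@ler_pM2l _ i.+1%:R) ?ltr0Sn // !uniform_KL_coefE; try lia.
by rewrite ler_nat leq_mul // leq_bin2l //; lia.
Qed.

(** For even d, [uniform_KL d] has no term in this degree. For d = 2j + 3, one of the binomials
    grows from 1 to j + 2. For d = 1 both polynomials are 1. *)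
Lemma uniform_KL_diff_gt0 d :
  d != 1%N -> 0 < (uniform_KL d.+1 - uniform_KL d)`_(d %/ 2).
Proof.
move=> d1; rewrite coefB subr_gt0 !coef_poly !gtn_uphalf_double.
set i := (d %/ 2)%N; rewrite (_ : i.*2 < d.+1)%N; last by rewrite /i; lia.
have id : (i < d.+1)%N by rewrite /i; lia.
rewrite -(@ltr_pM2l _ i.+1%:R) ?ltr0Sn // uniform_KL_coefE //.
have [i2|i2] := ltnP i.*2 d; last first.
  rewrite mulr0 ltr0n muln_gt0 !bin_gt0 /i; apply/andP; split; lia.
rewrite uniform_KL_coefE; last by lia.
have [j [ij dj]] : exists j, i = j.+1 /\ d = (j.+1).*2.+1.
  exists i.-1; move: d1 i2 id; rewrite /i; lia.
rewrite ltr_nat dj ij.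
rewrite (_ : (j.+1).*2.+1 - j.+2 = j.+1)%N; last by lia.
rewrite (_ : (j.+1).*2.+2 - j.+2 = j.+2)%N; last by lia.
rewrite binn mul1n binSn.
have h : ('C((j.+1).*2.+2, j.+1) <= 'C((j.+1).*2.+3, j.+1))%N by apply: leq_bin2l.
have : (0 < 'C((j.+1).*2.+2, j.+1))%N by rewrite bin_gt0; lia.
nia.
Qed.

Lemma coef_uniform_inverse_KL_diff d i :
  (uniform_inverse_KL d.+1 - uniform_inverse_KL d)`_i =
  if (2 * i < d.+1)%N then 'C(d.+1, i)%:R - (if i is j.+1 then 'C(d.+1, j)%:R else 0)
  else 0.
Proof.
rewrite coefB !coef_uniform_inverse_KL.
have [i1|i1] := ltnP (2 * i) d.+1; last by rewrite ifF ?subrr //; lia.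
(* The truncation loses nothing at 2i = d, where the two binomials agree. *)
have -> : (if (2 * i < d)%N then 'C(d.+1, i.+1)%:R - 'C(d.+1, i)%:R else 0) =
    'C(d.+1, i.+1)%:R - 'C(d.+1, i)%:R :> int.
  case: ifP => // i2; rewrite (_ : 'C(d.+1, i.+1) = 'C(d.+1, i)) ?subrr //.
  by rewrite -bin_sub; [congr 'C(_, _) |]; lia.
by rewrite !(binS d.+1) natrD; case: i {i1} => [|i]; rewrite ?bin0 ?binS ?natrD; ring.
Qed.

Lemma ltn_bin_half n j : (j.+1.*2 <= n)%N -> ('C(n, j) < 'C(n, j.+1))%N.
Proof.
move=> jn; rewrite -(ltn_pmul2l (ltn0Sn j)) mul_bin_left.
by rewrite ltn_pmul2r ?bin_gt0; lia.
Qed.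

Lemma uniform_inverse_KL_diff_gt0 d i : (2 * i < d.+1)%N ->
  0 < (uniform_inverse_KL d.+1 - uniform_inverse_KL d)`_i.
Proof.
move=> id; rewrite coef_uniform_inverse_KL_diff id; case: i id => [|i] id.
  by rewrite bin0 subr0.
by rewrite subr_gt0 ltr_nat ltn_bin_half //; lia.
Qed.

(** By [btS], the transform for d + 2 elements contains ['X] times the one for d + 1, which cancels
    against the factor [1 + 'X]. *)
Lemma uniform_Z_diff d : uniform_Z d.+1 - (1 + 'X) * uniform_Z d =
  bt 'X (fun m => uniform_KL m - uniform_KL m.-1) d.+1 - 'X^d.
Proof.
rewrite /uniform_Z btS /= -[in RHS](@eq_bt _ _ (fun m => uniform_KL m +
  -1 * uniform_KL m.-1)) => [|m]; last by rewrite mulN1r.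
rewrite btD btZ exprS; ring.
Qed.

Lemma size_uniform_KL_diff d :
  (size (uniform_KL d - uniform_KL d.-1)%R <= uphalf d)%N.
Proof.
apply: size_subr_le; rewrite ?size_uniform_KL //.
apply: (leq_trans (size_uniform_KL _)); apply: uphalf_leq; exact: leq_pred.
Qed.

Lemma size_uniform_Z_diff d :
  (size (uniform_Z d.+1 - (1 + 'X) * uniform_Z d)%R <= d.+1)%N.
Proof.
rewrite uniform_Z_diff size_subr_le ?size_polyXn //.
apply/leq_sizeP => i di; rewrite coef_sum big1 // => j _.
rewrite coefMn coefXnM; case: ltnP => ij; first by rewrite mul0rn.
rewrite nth_default ?mul0rn //; apply: (leq_trans (size_uniform_KL_diff _)).
rewrite leq_uphalf_double; lia.
Qed.

(** One bound for two purposes: non-negativity, and for d > 0 the degree. The value d at i = d is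
    the contribution d + 1 of the sets of size d, less the subtracted 1. *)
Lemma coef_uniform_Z_diff_ge d i :
  (if i == d then d%:R else 0) <= (uniform_Z d.+1 - (1 + 'X) * uniform_Z d)`_i.
Proof.
have pos m l : 0 <= (uniform_KL m - uniform_KL m.-1)`_l.
  by case: m => [|m]; rewrite ?subrr ?coef0 ?uniform_KL_diff_ge0.
have ge0 l (j : 'I_d.+2) : 0 <= (('X^j * (uniform_KL (d.+1 - j) -
    uniform_KL (d.+1 - j).-1)) *+ 'C(d.+1, j))`_l.
  by rewrite coefMn mulrn_wge0 // coefXnM; case: ifP.
rewrite uniform_Z_diff coefB coefXn coef_sum; case: eqVneq => [->|_]; last first.
  by rewrite subr0 sumr_ge0.
have dd : (d < d.+2)%N by [].
rewrite (bigD1 (Ordinal dd)) //= coefMn coefXnM ltnn subnn subSnn /=.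
rewrite uniform_KL0 uniform_KL1 subr0 coef1 /= binSn.
by rewrite addrAC [_ *+ d.+1]mulrSr mulr1n addrK lerDl sumr_ge0.
Qed.

Theorem theorem3p10 (P Q : matroid_poly) (hP : is_KL P) (hQ : is_inverse_KL Q)
    (k : nat) (hk : (1 <= k)%N) (p q z : {poly int})
    (hpqz : forall (T : finType) (M M' : matroid T) (H : {set T}),
      rank M = k -> circuit_hyperplane M H -> is_relaxation M H M' ->
      [/\ P T M' = P T M + p,
          Q T M' = Q T M + q
        & Zpoly P M' = Zpoly P M + z]) :
  [/\ forall i : nat, 0 <= p`_i,
      forall i : nat, 0 <= q`_i
    & forall i : nat, 0 <= z`_i] /\
  [/\ pdeg p = ((k - 1) %/ 2)%N,
      pdeg q = ((k - 1) %/ 2)%N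
    & pdeg z = (k - 1)%N] /\
  (* the degree of the zero polynomial is only involved for p at k = 2
     and for z at k = 1 *)
  [/\ k != 2%N -> p != 0, q != 0 & k != 1%N -> z != 0].
Proof.
case: k hk hpqz => // d _ hpqz; rewrite subn1 /=.
have cT : #|'I_d.+2| = d.+2 by rewrite card_ord.
(* A single pair [M], [M'] of rank k already determines p, q and z. *)
have [rM eP eQ eZ] := relaxation_differences ord0 cT hP hQ.
have [] := hpqz _ _ _ _ rM (circuit_hyperplane_coloop ord0 cT)
  (relaxation_coloop ord0 cT).
move=> hp hq hz; move: eP eQ eZ; rewrite {}hp {}hq {}hz !(addrC _ p, addrC _ q, addrC _ z).
rewrite !addrK => -> -> ->.
have p_ge0 := uniform_KL_diff_ge0 d.
have z_ge := coef_uniform_Z_diff_ge d.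
have q_gt0 : 0 < (uniform_inverse_KL d.+1 - uniform_inverse_KL d)`_(d %/ 2).
  by apply: uniform_inverse_KL_diff_gt0; lia.
have [qdeg q_n0] : pdeg (uniform_inverse_KL d.+1 - uniform_inverse_KL d) = (d %/ 2)%N
    /\ uniform_inverse_KL d.+1 - uniform_inverse_KL d != 0.
  apply: pdeg_eq q_gt0; rewrite -uphalfS_halfS size_subr_le ?size_poly //.
  exact: leq_trans (size_poly _ _) (uphalf_leq (leqnSn d)).
have p_size : (size (uniform_KL d.+1 - uniform_KL d)%R <= (d %/ 2).+1)%N.
  by rewrite -uphalfS_halfS (size_uniform_KL_diff d.+1).
have z_size := size_uniform_Z_diff d.
split; last (split; split => //).
- split=> i //; last by apply: le_trans (z_ge i); case: ifP.
  have [id|id] := ltnP (2 * i) d.+1; first exact/ltW/uniform_inverse_KL_diff_gt0.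
  by rewrite coef_uniform_inverse_KL_diff ifF //; lia.
(* For k = 2 the polynomial p is 0, and its size bound 1 gives [pdeg] 0; the case k = 1 of z below
   is similar. *)
- have [d1|d1] := eqVneq d 1%N; last by case: (pdeg_eq p_size (uniform_KL_diff_gt0 d1)).
  by rewrite d1 in p_size *; rewrite /pdeg; lia.
- have [d0|d0] := posnP d; first by rewrite d0 in z_size *; rewrite /pdeg; lia.
  case: (pdeg_eq z_size) => //; apply: lt_le_trans (z_ge d).
  by rewrite eqxx ltr0n.
- move=> d1; case: (pdeg_eq p_size (uniform_KL_diff_gt0 _)) => //.
- move=> d0; case: (pdeg_eq z_size) => //; apply: lt_le_trans (z_ge d).
  by rewrite eqxx ltr0n lt0n.
Qed.
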